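(* Let $A$ be a brace, let $x\in A$ be contained in a transitive cycle base of $A$, and let $(X,r):=(A,r_x)$. Then $$\mathrm{Aut}(X,r)=\{t_z\circ \psi\mid \psi\in \mathrm{Aut}(A,+,\circ),\ z\in A,\ \psi(x)=\lambda_z(x)\},$$ where $t_z\circ\psi$ denotes the composite map $a\mapsto \psi(a)\circ z$. Moreover, if $(X,r)$ has finite multipermutation level, then $|\mathrm{Aut}(X,r)|\leq |X|$.
   Context: A brace is a triple $(A,+,\circ)$ with $(A,+)$ an abelian group, $(A,\circ)$ a group, and $a\circ(b+c)=a\circ b-a+a\circ c$. Put $\lambda_a(b)=-a+a\circ b$; $\lambda:(A,\circ)\to\mathrm{Aut}(A,+)$ is a homomorphism. $\mathrm{Aut}(A,+,\circ)$ is the group of bijections of $A$ that are automorphisms of both groups. A transitive cycle base of a brace $A$ is a subset that is a single orbit of the action $\lambda$ of $(A,\circ)$ on $A$ and generates $(A,+)$. For $z\in A$, $t_z:A\to A$, $a\mapsto a\circ z$. A solution is a pair $(X,r)$ with $X$ a nonempty set and $r:X^2\to X^2$ a bijection, $r(x,y)=(\sigma_x(y),\tau_y(x))$, satisfying the braid equation $(r\times \mathrm{id})(\mathrm{id}\times r)(r\times \mathrm{id})=(\mathrm{id}\times r)(r\times \mathrm{id})(\mathrm{id}\times r)$ with all $\sigma_x,\tau_x$ bijective. An automorphism of $(X,r)$ is a bijection $f:X\to X$ with $(f\times f)r=r(f\times f)$; these form the group $\mathrm{Aut}(X,r)$. For $x$ in a transitive cycle base of the brace $A$, $r_x:A^2\to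 A^2$ is $r_x(a,b)=(\sigma_a(b),\sigma^{-1}_{\sigma_a(b)}(a))$ with $\sigma_a(b)=\lambda_a(x)\circ b$; it is known that $(A,r_x)$ is an (indecomposable, involutive) solution. The retraction $\mathrm{Ret}(X,r)$ is the induced solution on $X/{\sim}$, where $x\sim y$ iff $\sigma_x=\sigma_y$ and $\tau_x=\tau_y$; $(X,r)$ has finite multipermutation level if some iterated retraction has size $1$. *)

(* Defs.v *)
From HB Require Import structures.
From mathcomp Require Import all_boot all_order all_algebra generic_quotient.
From mathcomp Require Import boolp classical_sets functions cardinality.

Set Implicit Arguments.
Unset Strict Implicit.
Unset Printing Implicit Defensive.

Import GRing.Theory.

Local Open Scope classical_set_scope.
Local Open Scope card_scope.
Local Open Scope quotient_scope.
Local Open Scope ring_scope.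

(* The circle operation is the (multiplicatively written) [groupType] law. *)
Reserved Notation "a ∘ b" (at level 40, left associativity).
Notation "a ∘ b" := (a * b)%g : ring_scope.

HB.mixin Record Zmodule_Group_isBrace A of GRing.Zmodule A & Group A := {
  circDr : forall a b c : A, a ∘ (b + c) = a ∘ b - a + a ∘ c
}.

#[short(type="braceType")]
HB.structure Definition Brace :=
  {A of Zmodule_Group_isBrace A & GRing.Zmodule A & Group A}.

Section BraceDefs.
Variable A : braceType.
Implicit Types (a b c x z : A) (B H : set A) (psi : A -> A).

Definition lambda a b : A := - a + a ∘ b.

Definition translation z : A -> A := fun a => a ∘ z.

Definition brace_aut psi : Prop :=
  [/\ bijective psi, {morph psi : a b / a + b} & {morph psi : a b / a ∘ b}].

Definition additive_subgroup H : Prop :=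
  H 0 /\ (forall a b, H a -> H b -> H (a - b)).

Definition lambda_orbit b : set A := range (fun a => lambda a b).

Definition transitive_cycle_base B : Prop :=
  (exists b, B = lambda_orbit b) /\ smallest additive_subgroup B = setT.

End BraceDefs.

Section SolutionDefs.
Variables (X : Type) (r : X * X -> X * X).

Definition sol_sigma (x y : X) : X := (r (x, y)).1.
Definition sol_tau (y x : X) : X := (r (x, y)).2.

Definition map12 (p : X * X * X) : X * X * X := (r p.1, p.2).
Definition map23 (p : X * X * X) : X * X * X :=
  let q := r (p.1.2, p.2) in (p.1.1, q.1, q.2).

Definition is_solution : Prop :=
  [/\ bijective r,
      map12 \o map23 \o map12 =1 map23 \o map12 \o map23,
      forall x, bijective (sol_sigma x)
    & forall x, bijective (sol_tau x)].

End SolutionDefs.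

Record solution := Solution {
  sol_carrier :> choiceType;
  sol_map : sol_carrier * sol_carrier -> sol_carrier * sol_carrier;
  sol_inhabited : inhabited sol_carrier;
  sol_axiom : is_solution sol_map
}.

Definition square_map (X : Type) (f : X -> X) (p : X * X) : X * X :=
  (f p.1, f p.2).

Definition sol_aut (S : solution) : set (S -> S) :=
  [set f | bijective f /\
    square_map f \o @sol_map S =1 @sol_map S \o square_map f].
Arguments sol_aut : clear implicits.

(* The next sections prove, without any finiteness assumption, that the
   retraction of a solution is again a solution ([ret_solution]). *)

Lemma inj_surj_bij (T U : Type) (f : T -> U) :
  injective f -> (forall y, exists x, f x = y) -> bijective f.
Proof.
move=> fi fs; have [g gK] := choice fs.
by exists g => // x; apply: fi; rewrite gK.
Qed.

Lemma bij_surj (T U : Type) (f : T -> U) :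
  bijective f -> forall y, exists x, f x = y.
Proof. by case=> g _ gK y; exists (g y). Qed.

Definition ret_eq (X : Type) (r : X * X -> X * X) (x x' : X) : Prop :=
  sol_sigma r x = sol_sigma r x' /\ sol_tau r x = sol_tau r x'.

Lemma sol_mapE (X : Type) (r : X * X -> X * X) x y :
  r (x, y) = (sol_sigma r x y, sol_tau r y x).
Proof. by rewrite /sol_sigma /sol_tau -surjective_pairing. Qed.

Lemma sol_braidI (X : Type) (r : X * X -> X * X) (x y z : X) :
  let s := sol_sigma r in let t := sol_tau r in
  s (s x y) (s (t y x) z) = s x (s y z) ->
  t (s (t y x) z) (s x y) = s (t (s y z) x) (t z y) ->
  t z (t y x) = t (t z y) (t (s y z) x) ->
  (map12 r \o map23 r \o map12 r) (x, y, z) =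
  (map23 r \o map12 r \o map23 r) (x, y, z).
Proof.
move=> s t e1 e2 e3; rewrite /= /map12 /map23 /= [LHS]surjective_pairing /=.
by rewrite [in LHS]sol_mapE; congr (_, _, _).
Qed.

Section SolutionTheory.
Variables (X : Type) (r : X * X -> X * X) (rS : is_solution r).

Local Notation s := (sol_sigma r).
Local Notation t := (sol_tau r).
Local Notation "x ~ y" := (ret_eq r x y) (at level 70).

Lemma sol_braidE x y z :
  [/\ s (s x y) (s (t y x) z) = s x (s y z),
      t (s (t y x) z) (s x y) = s (t (s y z) x) (t z y)
    & t z (t y x) = t (t z y) (t (s y z) x)].
Proof.
case: rS => _ + _ _ => /(_ (x, y, z)); rewrite /= /map12 /map23 /=.
by case=> e1 e2; split; [exact: (congr1 fst e1) | exact: (congr1 snd e1) | exact: e2].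
Qed.

Lemma sol_sigma_inj x : injective (s x).
Proof. by case: rS => _ _ /(_ x)/bij_inj. Qed.

Lemma sol_tau_inj x : injective (t x).
Proof. by case: rS => _ _ _ /(_ x)/bij_inj. Qed.

Lemma sol_sigma_surj x y : exists z, s x z = y.
Proof. by case: rS => _ _ /(_ x)/bij_surj/(_ y). Qed.

Lemma sol_tau_surj x y : exists z, t x z = y.
Proof. by case: rS => _ _ _ /(_ x)/bij_surj/(_ y). Qed.

Lemma ret_eq_sigma x y y' : y ~ y' -> s x y ~ s x y'.
Proof.
move=> [sE tE]; split; apply/funext => w.
- have [z <-] := sol_sigma_surj (t y x) w.
  have [-> _ _] := sol_braidE x y z; rewrite sE tE.
  by have [-> _ _] := sol_braidE x y' z.
- have [_ _ e] := sol_braidE w x y; have [_ _ e'] := sol_braidE w x y'.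
  rewrite tE e' in e.
  have tyx : t y x = t y' x by rewrite tE.
  by rewrite -tyx in e; have := sol_tau_inj e.
Qed.

Lemma sol_sigma_fix y : exists x, s x y = x.
Proof.
have [w wE] := sol_tau_surj y y.
exists (s w y); have [z zE] := sol_sigma_surj y y.
by have [e _ _] := sol_braidE w y z; rewrite wE zE in e.
Qed.

Lemma ret_eq_tau_val a y y' : s a y ~ s a y' -> t y a = t y' a.
Proof.
move=> [_ tE].
have [x xE] := sol_sigma_fix a.
have aux v : t (s a v) x = s (t (s a v) x) (t v a).
  have [e1 e2 _] := sol_braidE x a v; rewrite xE in e1 e2.
  by rewrite -e2; congr (t _ x); apply/esym/(sol_sigma_inj e1).
by have := aux y; rewrite tE [LHS]aux => /sol_sigma_inj.
Qed.

Lemma ret_eq_sigma_inj x y y' : s x y ~ s x y' -> y ~ y'.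
Proof.
move=> uu'; have tE := ret_eq_tau_val uu'; case: (uu') => sU tU.
split; apply/funext => w.
- apply: (@sol_sigma_inj x).
  have [<- _ _] := sol_braidE x y w.
  by have [<- _ _] := sol_braidE x y' w; rewrite sU tE.
- have [p <-] := sol_tau_surj x w.
  have [_ _ ->] := sol_braidE p x y.
  by have [_ _ ->] := sol_braidE p x y'; rewrite tU tE.
Qed.

Lemma ret_eq_map_inv_l x y x' y' :
  s x y ~ s x' y' -> t y x = t y' x' -> x = x'.
Proof.
move=> uu' vv'; have [y2 y2E] := sol_sigma_surj x (s x' y').
have := @ret_eq_tau_val x y y2; rewrite y2E => /(_ uu') tE.
have : r (x, y2) = r (x', y') by rewrite !sol_mapE y2E -tE vv'.
by case: rS => /bij_inj ri _ _ _ /ri [].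
Qed.

End SolutionTheory.

Section Mirror.
Variables (X : Type) (r : X * X -> X * X).

Definition mirror (p : X * X) : X * X := let q := r (p.2, p.1) in (q.2, q.1).

Lemma mirror_sigma : sol_sigma mirror = sol_tau r. Proof. by []. Qed.
Lemma mirror_tau : sol_tau mirror = sol_sigma r. Proof. by []. Qed.

Lemma mirror_solution : is_solution r -> is_solution mirror.
Proof.
move=> rS; case: (rS) => [[g rK gK] _ sB tB]; split=> //.
- exists (fun p => let q := g (p.2, p.1) in (q.2, q.1)).
    by case=> x y; rewrite /mirror /= -surjective_pairing rK.
  by case=> x y; rewrite /mirror /= -surjective_pairing gK.
- move=> [[z y] x]; have [e1 e2 e3] := sol_braidE rS x y z.
  exact: sol_braidI.
Qed.

Lemma mirror_ret_eq x y : ret_eq mirror x y <-> ret_eq r x y.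
Proof. by rewrite /ret_eq mirror_sigma mirror_tau; split=> -[]. Qed.

End Mirror.

Section Inverse.
Variables (X : Type) (r g : X * X -> X * X).
Hypotheses (rS : is_solution r) (rK : cancel r g) (gK : cancel g r).

Lemma inverse_sigma x y : sol_sigma g (sol_sigma r x y) (sol_tau r y x) = x.
Proof. by rewrite [LHS]/sol_sigma -sol_mapE rK. Qed.

Lemma inverse_tau x y : sol_tau g (sol_tau r y x) (sol_sigma r x y) = y.
Proof. by rewrite [LHS]/sol_tau -sol_mapE rK. Qed.

Lemma inverse_eq u v : exists x y, u = sol_sigma r x y /\ v = sol_tau r y x.
Proof.
exists (g (u, v)).1, (g (u, v)).2.
by rewrite /sol_sigma /sol_tau -surjective_pairing gK.
Qed.

Lemma inverse_solution : is_solution g.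
Proof.
have [_ rB _ _] := rS.
have K12 : cancel (map12 g) (map12 r) by case=> p z; rewrite /map12 /= gK.
have K12' : cancel (map12 r) (map12 g) by case=> p z; rewrite /map12 /= rK.
have K23 : cancel (map23 g) (map23 r).
  by case=> [[x y] z]; rewrite /map23 /= -surjective_pairing gK.
have K23' : cancel (map23 r) (map23 g).
  by case=> [[x y] z]; rewrite /map23 /= -surjective_pairing rK.
split; first by exists r.
- move=> p /=; set q := RHS.
  have -> : p = map23 r (map12 r (map23 r q)) by rewrite /q K23 K12 K23.
  by have /= <- := rB q; rewrite K12' K23' K12'.
- move=> u; apply: inj_surj_bij => [v v'|x].
    have [x [y [-> ->]]] := inverse_eq u v.
    have [x' [y' [e ->]]] := inverse_eq (sol_sigma r x y) v'.
    rewrite inverse_sigma e inverse_sigma => xx'.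
    by move: e; rewrite xx' => /(sol_sigma_inj rS) ->.
  have [y <-] := sol_sigma_surj rS x u.
  by exists (sol_tau r y x); rewrite inverse_sigma.
- move=> v; apply: inj_surj_bij => [u u'|y].
    have [x [y [-> ->]]] := inverse_eq u v.
    have [x' [y' [-> e]]] := inverse_eq u' (sol_tau r y x).
    rewrite inverse_tau e inverse_tau => yy'.
    by move: e; rewrite yy' => /(sol_tau_inj rS) ->.
  have [x <-] := sol_tau_surj rS y v.
  by exists (sol_sigma r x y); rewrite inverse_tau.
Qed.

Lemma ret_eq_inverse u u' : ret_eq r u u' -> ret_eq g u u'.
Proof.
move=> uu'; split; apply/funext => v.
- have [x [y [uE vE]]] := inverse_eq u v.
  have [x' [y' [uE' vE']]] := inverse_eq u' v.
  have -> : sol_sigma g u v = x by rewrite uE vE inverse_sigma.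
  have -> : sol_sigma g u' v = x' by rewrite uE' vE' inverse_sigma.
  by apply: (ret_eq_map_inv_l rS (y := y) (y' := y'));
    [rewrite -uE -uE' | rewrite -vE].
- have [x [y [vE uE]]] := inverse_eq v u.
  have [x' [y' [vE' uE']]] := inverse_eq v u'.
  have -> : sol_tau g u v = y by rewrite uE vE inverse_tau.
  have -> : sol_tau g u' v = y' by rewrite uE' vE' inverse_tau.
  apply: (ret_eq_map_inv_l (mirror_solution rS) (y := x) (y' := x'));
    rewrite !(mirror_sigma, mirror_tau); last by rewrite -vE.
  by rewrite -uE -uE'; apply/mirror_ret_eq.
Qed.

End Inverse.

Section RetractionTheory.
Variables (X : Type) (r : X * X -> X * X) (rS : is_solution r).

Local Notation s := (sol_sigma r).
Local Notation t := (sol_tau r).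
Local Notation "x ~ y" := (ret_eq r x y) (at level 70).

Lemma ret_eq_tau y x x' : x ~ x' -> t y x ~ t y x'.
Proof.
by move=> /mirror_ret_eq/(ret_eq_sigma (mirror_solution rS) y)/mirror_ret_eq.
Qed.

Lemma ret_eq_tau_inj y x x' : t y x ~ t y x' -> x ~ x'.
Proof.
by move=> /mirror_ret_eq/(ret_eq_sigma_inj (mirror_solution rS))/mirror_ret_eq.
Qed.

Lemma ret_eq_map x y x' y' : x ~ x' -> y ~ y' ->
  s x y ~ s x' y' /\ t y x ~ t y' x'.
Proof.
move=> xx' yy'; case: (xx') (yy') => sE _ [_ tE].
by split; [rewrite -sE; apply: ret_eq_sigma | rewrite -tE; apply: ret_eq_tau].
Qed.

End RetractionTheory.

Lemma ret_eq_map_inj (X : Type) (r : X * X -> X * X) (x y x' y' : X) :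
  is_solution r ->
  ret_eq r (sol_sigma r x y) (sol_sigma r x' y') ->
  ret_eq r (sol_tau r y x) (sol_tau r y' x') ->
  ret_eq r x x' /\ ret_eq r y y'.
Proof.
move=> rS uu' vv'; have [[g rK gK] _ _ _] := rS.
have gS := inverse_solution rS rK gK.
have [] := ret_eq_map gS (ret_eq_inverse rS rK gK uu')
  (ret_eq_inverse rS rK gK vv').
rewrite !inverse_sigma // !inverse_tau //.
by move=> /(ret_eq_inverse gS gK rK) ? /(ret_eq_inverse gS gK rK).
Qed.

Section Retraction.
Variable S : solution.

Local Notation r := (@sol_map S).

Definition ret_rel : rel S := fun x y => `[< ret_eq r x y >].

Lemma ret_rel_equiv : equiv_class_of ret_rel.
Proof.
split=> [x|x y|y x z]; first exact/asboolP.
- by apply: asbool_equiv_eq; split=> -[sE tE]; split.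
- by move=> /asboolP[sE tE] /asboolP[sE' tE']; apply/asboolP; split;
    [rewrite sE | rewrite tE].
Qed.

Canonical ret_equiv_rel := EquivRelPack ret_rel_equiv.

Definition ret_carrier : choiceType := {eq_quot ret_equiv_rel}.

Definition ret_pi : S -> ret_carrier := \pi_{eq_quot ret_equiv_rel}.

Lemma ret_piP x y : ret_pi x = ret_pi y <-> ret_eq r x y.
Proof. by split=> [/eqmodP/asboolP //|h]; apply/eqmodP/asboolP. Qed.

Lemma ret_pi_surj (a : ret_carrier) : exists x, ret_pi x = a.
Proof. by exists (repr a); rewrite /ret_pi reprK. Qed.

(* Defined on representatives; independence of the choice is [ret_mapE]. *)
Definition ret_map (p : ret_carrier * ret_carrier) : ret_carrier * ret_carrier :=
  let q := r (repr p.1, repr p.2) in (ret_pi q.1, ret_pi q.2).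

Lemma ret_mapE x y :
  ret_map (ret_pi x, ret_pi y) = (ret_pi (r (x, y)).1, ret_pi (r (x, y)).2).
Proof.
have reprE z : ret_eq r (repr (ret_pi z)) z.
  by apply/ret_piP; rewrite /ret_pi reprK.
have [e1 e2] := ret_eq_map (sol_axiom S) (reprE x) (reprE y).
by congr (_, _); apply/ret_piP.
Qed.

Lemma ret_sigmaE x y :
  sol_sigma ret_map (ret_pi x) (ret_pi y) = ret_pi (sol_sigma r x y).
Proof. by rewrite {1}/sol_sigma ret_mapE. Qed.

Lemma ret_tauE x y :
  sol_tau ret_map (ret_pi x) (ret_pi y) = ret_pi (sol_tau r x y).
Proof. by rewrite {1}/sol_tau ret_mapE. Qed.

Lemma ret_solution : is_solution ret_map.
Proof.
have rS := sol_axiom S; split.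
- apply: inj_surj_bij => [[a b] [a' b']|[a b]].
    have [x <-] := ret_pi_surj a; have [y <-] := ret_pi_surj b.
    have [x' <-] := ret_pi_surj a'; have [y' <-] := ret_pi_surj b'.
    rewrite !ret_mapE => -[/ret_piP e1 /ret_piP e2].
    have [e3 e4] := ret_eq_map_inj rS e1 e2.
    by congr (_, _); apply/ret_piP.
  have [x <-] := ret_pi_surj a; have [y <-] := ret_pi_surj b.
  have [/bij_surj/(_ (x, y))[[x' y'] e] _ _ _] := rS.
  by exists (ret_pi x', ret_pi y'); rewrite ret_mapE e.
- move=> [[a b] c].
  have [x <-] := ret_pi_surj a; have [y <-] := ret_pi_surj b.
  have [z <-] := ret_pi_surj c.
  have [e1 e2 e3] := sol_braidE rS x y z.
  by apply: sol_braidI; rewrite !(ret_sigmaE, ret_tauE) ?e1 ?e2 ?e3.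
- move=> a; have [x <-] := ret_pi_surj a.
  apply: inj_surj_bij => [b b'|b].
    have [y <-] := ret_pi_surj b; have [y' <-] := ret_pi_surj b'.
    rewrite !ret_sigmaE => /ret_piP/(ret_eq_sigma_inj rS) ?.
    exact/ret_piP.
  have [y <-] := ret_pi_surj b; have [z <-] := sol_sigma_surj rS x y.
  by exists (ret_pi z); rewrite ret_sigmaE.
- move=> a; have [x <-] := ret_pi_surj a.
  apply: inj_surj_bij => [b b'|b].
    have [y <-] := ret_pi_surj b; have [y' <-] := ret_pi_surj b'.
    rewrite !ret_tauE => /ret_piP/(ret_eq_tau_inj rS) ?.
    exact/ret_piP.
  have [y <-] := ret_pi_surj b; have [z <-] := sol_tau_surj rS x y.
  by exists (ret_pi z); rewrite ret_tauE.
Qed.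

Lemma ret_inhabited : inhabited ret_carrier.
Proof. by have [x] := sol_inhabited S; exists; exact: ret_pi x. Qed.

Definition Ret : solution := Solution ret_inhabited ret_solution.

End Retraction.

Definition finite_multipermutation_level (S : solution) : Prop :=
  exists n : nat, [set: iter n Ret S] #= [set: unit].

Section BraceSolution.
Variable A : braceType.
Implicit Types a b c x z : A.

Lemma circ0 a : a ∘ 0 = a.
Proof.
have := circDr a 0 0; rewrite addr0 => /esym/eqP.
by rewrite -addrA -[X in _ == X]addr0 (inj_eq (addrI _)) addrC subr_eq0 => /eqP.
Qed.

Lemma one_zero : (1%g : A) = 0.
Proof. by rewrite -[LHS]circ0 mul1g. Qed.

Lemma circE a b : a ∘ b = a + lambda a b.
Proof. by rewrite /lambda addrA subrr add0r. Qed.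

Lemma lambdaD a b c : lambda a (b + c) = lambda a b + lambda a c.
Proof. by rewrite /lambda circDr -!addrA. Qed.

Lemma lambdaM a b c : lambda (a ∘ b) c = lambda a (lambda b c).
Proof.
apply: (@addrI _ (a ∘ b)); rewrite -circE -mulgA [b ∘ c]circE.
by rewrite [LHS]circE lambdaD addrA -circE.
Qed.

Variable x : A.

(* [brace_sigma_inv a] is the inverse of the permutation [brace_sigma a]. *)
Definition brace_sigma a b : A := lambda a x ∘ b.
Definition brace_sigma_inv a b : A := (lambda a x)^-1%g ∘ b.

Lemma brace_sigmaK a : cancel (brace_sigma a) (brace_sigma_inv a).
Proof. by move=> b; rewrite /brace_sigma /brace_sigma_inv mulKg. Qed.

Lemma brace_sigma_invK a : cancel (brace_sigma_inv a) (brace_sigma a).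
Proof. by move=> b; rewrite /brace_sigma /brace_sigma_inv mulVKg. Qed.

Definition brace_map (p : A * A) : A * A :=
  let c := brace_sigma p.1 p.2 in (c, brace_sigma_inv c p.1).

Lemma brace_map_involutive : involutive brace_map.
Proof.
move=> [a b]; rewrite /brace_map /=.
by rewrite brace_sigma_invK brace_sigmaK.
Qed.

Lemma circ_lambda a b : a ∘ lambda a^-1%g b = a + b.
Proof. by rewrite circE -lambdaM mulgV /lambda one_zero oppr0 add0r -one_zero mul1g. Qed.

Lemma circBr a b c : a ∘ (b - c) = a ∘ b - a ∘ c + a.
Proof.
by apply: (addIr (- a + a ∘ c)); rewrite [LHS]addrA -circDr [RHS]addrA addrK !subrK.
Qed.

Local Notation s := (sol_sigma brace_map).
Local Notation t := (sol_tau brace_map).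

Lemma brace_braid1 a b c : s (s a b) (s (t b a) c) = s a (s b c).
Proof.
rewrite /sol_sigma /sol_tau /= /brace_sigma_inv /brace_sigma !mulgA.
congr (_ ∘ c); rewrite !lambdaM circ_lambda.
by rewrite circE addrC.
Qed.

Lemma brace_tauE b a : s (s a b) (t b a) = a.
Proof. exact: brace_sigma_invK. Qed.

Lemma brace_braid2 a b c :
  t (s (t b a) c) (s a b) = s (t (s b c) a) (t c b).
Proof.
apply: (can_inj (brace_sigmaK (s a (s b c)))).
rewrite -[LHS]/(s _ _) -[RHS]/(s _ _) brace_braid1 brace_tauE.
by rewrite -brace_braid1 brace_tauE.
Qed.

Lemma brace_braid3 a b c : t c (t b a) = t (t c b) (t (s b c) a).
Proof.
set u := s a b; set v := s (t b a) c; set w := s a (s b c).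
have e : s u v = w by rewrite brace_braid1.
have e2 : t v u = s (t (s b c) a) (t c b) by rewrite brace_braid2.
apply: (can_inj (brace_sigmaK (t v u))); rewrite -[LHS]/(s _ _).
rewrite -[RHS]/(s _ _) {2}e2 brace_tauE.
apply: (can_inj (brace_sigmaK w)); rewrite -[LHS]/(s _ _) -[RHS]/(s _ _).
by rewrite brace_tauE -{1}e brace_braid1 brace_tauE brace_tauE.
Qed.

Lemma brace_tau_inv b a : (t b a)^-1%g + x = (x + a^-1%g) ∘ lambda b x.
Proof.
rewrite /sol_tau /= /brace_sigma_inv invgM invgK {1}/lambda [- _ + _]addrC.
rewrite circBr /brace_sigma !mulgA.
have -> : a^-1%g ∘ lambda a x = x + a^-1%g.
  by rewrite /lambda [- _ + _]addrC circBr mulKg mulVg one_zero subr0.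
set m := x + _; rewrite -addrA [a^-1%g + x]addrC -/m [LHS]addrAC.
rewrite [RHS]circE -lambdaM /lambda.
by rewrite [RHS]addrC addrAC [- _ + _]addrC addrAC.
Qed.

Lemma brace_map_solution : is_solution brace_map.
Proof.
split.
- exact: inv_bij brace_map_involutive.
- move=> [[a b] c].
  exact: sol_braidI (brace_braid1 a b c) (brace_braid2 a b c) (brace_braid3 a b c).
- by move=> a; exists (brace_sigma_inv a);
    [exact: brace_sigmaK | exact: brace_sigma_invK].
- move=> b; apply: inj_surj_bij => [a a' e|d].
    have := brace_tau_inv b a; rewrite e brace_tau_inv.
    by move=> /mulIg/addrI/invg_inj.
  exists ((d^-1%g + x) ∘ (lambda b x)^-1 - x)^-1%g.
  apply/invg_inj/(@addIr _ x); rewrite brace_tau_inv invgK.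
  by rewrite addrC subrK mulgVK.
Qed.

Definition brace_solution : solution :=
  Solution (inhabits (0 : A)) brace_map_solution.

End BraceSolution.

(* Main.v *)
(** An automorphism intertwines the permutations [sigma_a], and for the brace
    solution these are the left translations by the elements of the [lambda]-orbit
    of [x]. That orbit generates the multiplicative group, as it generates the
    additive one and is [lambda]-invariant. So an automorphism [f], divided by
    [f 0] on the right, is multiplicative because it respects left
    multiplication by the orbit; it then sends [lambda a x] to
    [lambda (psi a) (psi x)], which makes it additive because it respects addition
    of elements of the orbit. For the cardinality bound, an automorphism that acts
    trivially on the retraction commutes with every [sigma_a]; as these generate a
    transitive group, by induction on the multipermutation level an automorphism
    with a fixed point is the identity, hence [f |-> f 0] is injective. *)

Require Import Defs.
From mathcomp Require Import all_boot all_order all_algebra.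
From mathcomp Require Import boolp classical_sets functions cardinality.

Set Implicit Arguments.
Unset Strict Implicit.
Unset Printing Implicit Defensive.

Import GRing.Theory.

Local Open Scope classical_set_scope.
Local Open Scope card_scope.
Local Open Scope ring_scope.

(* The group generated by the [sigma_a] is transitive, as an induction principle:
   its orbit of [p] is the smallest set stable under each [sigma_a] and inverse. *)
Definition sigma_transitive (S : solution) (p : S) : Prop :=
  forall P : S -> Prop, P p ->
    (forall a b, P b <-> P (sol_sigma (@sol_map S) a b)) -> forall b, P b.

Definition sol_morph (S : solution) (f : S -> S) : Prop :=
  square_map f \o @sol_map S =1 @sol_map S \o square_map f.

Lemma sol_morphE (S : solution) (f : S -> S) : sol_morph f ->
  {morph f : a b / sol_sigma (@sol_map S) a b} /\
  {morph f : b a / sol_tau (@sol_map S) b a}.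
Proof.
move=> fM; split=> a b; first by have := congr1 fst (fM (a, b)).
by have := congr1 snd (fM (b, a)).
Qed.

Lemma sol_morph_comp (S : solution) (f g : S -> S) :
  sol_morph f -> sol_morph g -> sol_morph (f \o g).
Proof.
move=> fM gM q; have := gM q; have := fM (square_map g q).
by rewrite /= => <- <-.
Qed.

Lemma sol_morph_inv (S : solution) (f g : S -> S) :
  cancel f g -> cancel g f -> sol_morph f -> sol_morph g.
Proof.
move=> fK gK fM q.
have sfK : cancel (square_map f) (square_map g).
  by case=> a b; rewrite /square_map /= !fK.
have sgK : cancel (square_map g) (square_map f).
  by case=> a b; rewrite /square_map /= !gK.
apply: (can_inj sfK); have := fM (square_map g q).
by rewrite /= !sgK.
Qed.

(** Every point is some [f c], and there the maps of [f a] are read off from those of [a]. *)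
Lemma ret_eq_morph (S : solution) (f : S -> S) a b : sol_morph f ->
  (forall y, exists c, f c = y) ->
  ret_eq (@sol_map S) a b -> ret_eq (@sol_map S) (f a) (f b).
Proof.
move=> /sol_morphE[fs ft] f_surj [sE tE].
by split; apply/funext => y; have [c <-] := f_surj y; rewrite -?fs -?ft ?sE ?tE.
Qed.

Lemma sigma_transitive_Ret (S : solution) (p : S) :
  sigma_transitive p -> @sigma_transitive (Ret S) (ret_pi p).
Proof.
move=> Sp P Pp Ps b; have [c <-] := ret_pi_surj b.
apply: (Sp (fun y => P (ret_pi y))) => // a y.
rewrite (Ps (ret_pi a)).
by have -> := ret_sigmaE a y.
Qed.

Lemma morph_fixpoint_id n (S : solution) (p : S) (f : S -> S) :
  (forall a b : iter n Ret S, a = b) -> sigma_transitive p ->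
  sol_morph f -> (forall y, exists c, f c = y) -> f p = p -> f =1 id.
Proof.
elim: n S p f => [|n IHn] S p f Sn Sp fM f_surj fp; first by move=> a; exact: Sn.
have Rn : forall a b : iter n Ret (Ret S), a = b by rewrite -iterSr.
(* The map induced by [f] on the retraction, to which induction applies. *)
pose g : Ret S -> Ret S := fun a => ret_pi (f (repr a)).
have gE a : g (ret_pi a) = ret_pi (f a).
  by apply/ret_piP/ret_eq_morph => //; apply/ret_piP; rewrite /ret_pi reprK.
have [fs ft] := sol_morphE fM.
have g_id : g =1 id.
  apply: (IHn (Ret S) (ret_pi p)) => //; first exact: sigma_transitive_Ret.
  - move=> [a b]; have [a' <-] := ret_pi_surj a; have [b' <-] := ret_pi_surj b.
    rewrite -[LHS]/(square_map g (ret_map (ret_pi a', ret_pi b'))).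
    rewrite -[RHS]/(ret_map (g (ret_pi a'), g (ret_pi b'))).
    rewrite !gE !ret_mapE /square_map !gE.
    by congr (ret_pi _, ret_pi _); [exact: fs | exact: ft].
  - move=> y; have [y' <-] := ret_pi_surj y; have [c <-] := f_surj y'.
    by exists (ret_pi c).
  - by rewrite gE fp.
have f_sigma a b :
    f (sol_sigma (@sol_map S) a b) = sol_sigma (@sol_map S) a (f b).
  have /ret_piP[sE _] : ret_pi (f a) = ret_pi a by rewrite -gE g_id.
  by rewrite fs sE.
(* Commuting with each [sigma_a], [f] has a set of fixed points stable under them and their
   inverses. *)
apply: (Sp (fun y => f y = y)) => // a b; rewrite f_sigma.
by split=> [-> //|/(sol_sigma_inj (sol_axiom S))].
Qed.

Lemma sol_aut_card_le (S : solution) (p : S) : sigma_transitive p ->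
  finite_multipermutation_level S -> @sol_aut S #<= [set: S].
Proof.
move=> Sp [n Sn].
have Sn1 (a b : iter n Ret S) : a = b.
  have /pcard_eqP[h] := Sn.
  have h_inj : {in [set: iter n Ret S] &, injective h} by exact: inj.
  by apply: h_inj; rewrite ?in_setT//; case: (h a); case: (h b).
pose ev := fun f : S -> S => f p.
have ev_inj : {in @sol_aut S &, injective ev}.
  move=> f g /set_mem[f_bij fM] /set_mem[[g' gK g'K] gM] fpgp.
  have g'fM := sol_morph_comp (sol_morph_inv gK g'K gM) fM.
  have g'f_id : g' \o f =1 id.
    apply: (morph_fixpoint_id Sn1 Sp g'fM); last by rewrite /= [f p]fpgp gK.
    by apply: bij_surj; apply: bij_comp f_bij; exists g.
  by apply/funext => a; rewrite -[in RHS](g'f_id a) /= g'K.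
have /card_eqPle[_ /card_le_trans] := inj_card_eq ev_inj.
by apply; exact: card_leT.
Qed.

Section BraceLambda.
Variable A : braceType.
Implicit Types a b c x z : A.

Lemma lambda0 b : lambda 0 b = b.
Proof. by rewrite /lambda oppr0 add0r -one_zero mul1g. Qed.

Definition lambda_generates x : Prop :=
  forall K : set A, additive_subgroup K -> (forall a, K (lambda a x)) ->
    forall b, K b.

Lemma transitive_cycle_base_generates (B : set A) x :
  transitive_cycle_base B -> B x -> lambda_generates x.
Proof.
move=> [[y BE] BT] Bx K Kg Kx b.
suff : smallest (@additive_subgroup A) B `<=` K by apply; rewrite BT.
apply: smallest_sub => // c; move: Bx; rewrite BE => -[d _ xE] [e _ <-].
(* The orbit of [y] is also that of [x]: if [x = lambda d y], then
   [lambda e y = lambda (e ∘ d^-1) x]. *)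
by have := Kx (e ∘ d^-1%g); rewrite -xE -lambdaM mulgVK.
Qed.

(** The [b] with [H + b] and [H - b] inside [H] form an additive subgroup. It contains the orbit,
    since [h + lambda a x = h ∘ lambda (h^-1 ∘ a) x]. Take [h = 1 = 0] to conclude. *)
Lemma lambda_generates_circ x (H : set A) : lambda_generates x ->
  H 1%g -> (forall a b, H a -> H b -> H (a ∘ b^-1)) ->
  (forall a, H (lambda a x)) -> forall b, H b.
Proof.
move=> gx H1 HD Hx b.
have HV a : H a -> H a^-1%g by move=> Ha; rewrite -[_^-1%g]mul1g; exact: HD.
have HM a c : H a -> H c -> H (a ∘ c).
  by move=> Ha Hc; rewrite -[c]invgK; apply/HD/HV.
suff : forall h, H h -> H (h + b) /\ H (h - b).
  by move=> /(_ _ H1)[+ _]; rewrite one_zero add0r.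
apply: (gx (fun b => forall h, H h -> H (h + b) /\ H (h - b))) => [|a h Hh].
  split=> [h Hh|a c Ka Kc h Hh]; first by rewrite subr0 addr0.
  split; first by rewrite addrA; apply: (Kc _ (Ka _ Hh).1).2.
  by rewrite opprB addrA addrAC; apply: (Kc _ (Ka _ Hh).2).1.
split; first by rewrite -circ_lambda -lambdaM; exact: HM.
(* The same identity for [k = h - lambda a x], solved for [k]. *)
suff -> : h - lambda a x = h ∘ (lambda ((h - lambda a x)^-1 ∘ a) x)^-1%g.
  exact: HD.
by apply: (canRL (mulgK _)); rewrite lambdaM circ_lambda subrK.
Qed.

(** The [b] whose left multiplication preserves [P] in both directions form a subgroup for [∘];
    evaluate at [c = 1 = 0]. *)
Lemma brace_solution_transitive x :
  lambda_generates x -> @sigma_transitive (brace_solution x) 0.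
Proof.
move=> gx P P0 Ps b.
suff : forall c, P c <-> P (b ∘ c).
  by move=> /(_ 1%g); rewrite mulg1 one_zero => <-.
apply: (lambda_generates_circ (H := fun b => forall c, P c <-> P (b ∘ c)) gx).
- by move=> c; rewrite mul1g.
- move=> a d Pa Pd c; rewrite -mulgA -Pa.
  by rewrite (Pd (d^-1 ∘ c)%g) mulVKg.
- by move=> a c; exact: Ps.
Qed.

Lemma brace_aut_lambda psi a b : brace_aut psi ->
  psi (lambda a b) = lambda (psi a) (psi b).
Proof.
by case=> _ pD pM; apply: (addrI (psi a)); rewrite -pD -!circE pM.
Qed.

Lemma translation_bij z : bijective (@translation A z).
Proof.
by exists (translation z^-1%g) => a; rewrite /translation (mulgK, mulgVK).
Qed.

(** Here [tau] is determined by [sigma]. *)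
Lemma brace_map_morph x (f : A -> A) :
  {morph f : a b / brace_sigma x a b} ->
  square_map f \o brace_map x =1 brace_map x \o square_map f.
Proof.
move=> fs [a b]; rewrite /square_map /brace_map /= -fs; congr (_, _).
apply: (can_inj (brace_sigmaK x (f (brace_sigma x a b)))).
by rewrite -fs !brace_sigma_invK.
Qed.

Lemma translation_comp_brace_aut x z psi : brace_aut psi ->
  psi x = lambda z x -> @sol_aut (brace_solution x) (translation z \o psi).
Proof.
move=> pA px; have [p_bij pD pM] := pA.
split; first exact: bij_comp (translation_bij z) p_bij.
apply: brace_map_morph => a b /=; rewrite /brace_sigma /translation.
by rewrite pM brace_aut_lambda// px -lambdaM mulgA.
Qed.

Lemma sol_aut_brace x f : lambda_generates x ->
  @sol_aut (brace_solution x) f -> exists psi z,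
    [/\ brace_aut psi, psi x = lambda z x & f = translation z \o psi].
Proof.
move=> gx [f_bij fM]; have [fs _] := sol_morphE fM.
have {fM}fs a b : f (lambda a x ∘ b) = lambda (f a) x ∘ f b by exact: fs.
(* This [z] is forced, as a brace automorphism fixes [0 = 1]. *)
pose z := f 0; pose psi := @translation A z^-1%g \o f.
have fE a : f a = psi a ∘ z by rewrite /psi /translation /= mulgVK.
have p0 : psi 0 = 0 by rewrite /psi /translation /= mulgV one_zero.
have pE a : psi (lambda a x) = lambda (f a) x.
  by apply: (mulIg z); rewrite -fE -fs circ0.
have pM : {morph psi : a b / a ∘ b}.
  (* The [a] with [psi (a ∘ b) = psi a ∘ psi b] for all [b] form a subgroup for [∘]. *)
  apply: (lambda_generates_circ gx) => [b|a c Ha Hc b|a b].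
  - by rewrite -one_zero in p0; rewrite p0 !mul1g.
  - have pV e : psi (c^-1 ∘ e)%g = (psi c)^-1%g ∘ psi e.
      by apply: (mulgI (psi c)); rewrite -Hc !mulVKg.
    have pVc : psi c^-1%g = (psi c)^-1%g.
      by have := pV 1%g; rewrite one_zero p0 -one_zero !mulg1.
    by rewrite -mulgA !Ha pV pVc mulgA.
  - by rewrite pE {1}/psi /translation /= fs mulgA.
have px : psi x = lambda z x by have := pE 0; rewrite lambda0.
have pL a : psi (lambda a x) = lambda (psi a) (psi x).
  by rewrite pE fE lambdaM px.
have pD : {morph psi : a b / a + b}.
  suff pD b a : psi (a + b) = psi a + psi b by [].
  move: b a; apply: (gx (fun b => forall a, psi (a + b) = psi a + psi b)).
    split=> [a|b c Hb Hc a]; first by rewrite p0 !addr0.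
    have pB e : psi (e - c) = psi e - psi c.
      by rewrite -[in RHS](subrK c e) Hc addrK.
    by rewrite addrA !pB Hb addrA.
  move=> c a.
  (* Writing [a + lambda c x] as [a ∘ lambda (a^-1 ∘ c) x] reduces additivity to
     multiplicativity. *)
  rewrite -[in LHS]circ_lambda -lambdaM pM !pL -[RHS]circ_lambda -lambdaM.
  congr (_ ∘ lambda _ _); apply: (mulgI (psi a)).
  by rewrite -pM !mulVKg.
exists psi, z; split=> //.
- split=> //; exact: bij_comp (translation_bij _) f_bij.
- by apply/funext => a; rewrite /= {1}fE.
Qed.

End BraceLambda.

Theorem proposition6p2 (A : braceType) (x : A)
  (hx : exists B : set A, transitive_cycle_base B /\ B x) :
  sol_aut (brace_solution x) =
    [set f : A -> A | exists (psi : A -> A) (z : A),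
       [/\ brace_aut psi, psi x = lambda z x & f = translation z \o psi]] /\
  (finite_multipermutation_level (brace_solution x) ->
     sol_aut (brace_solution x) #<= [set: brace_solution x]).
Proof.
have [B [Bbase Bx]] := hx.
have gx := transitive_cycle_base_generates Bbase Bx.
split; last exact: sol_aut_card_le (brace_solution_transitive gx).
apply/seteqP; split=> [f|f [psi [z [pA px ->]]]]; first exact: sol_aut_brace.
exact: translation_comp_brace_aut.
Qed.
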